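(* Let $c>0$ and $\alpha<1/2$ be real numbers and let $(N_n)_{n\geq1}$ be a sequence of positive integers with $N_n\sim c^{-1}n^{\alpha}$ as $n\to\infty$. For each $n$ let $\lambda_n$ be a random Young diagram of size $n$ distributed according to the Schur-Weyl measure of parameters $n$ and $N_n$. Draw $\lambda_n$ in the quadrant $x\geq0$, $y\geq0$ with its rows horizontal and left-justified, stacked upwards from the longest (lying on the $x$-axis) to the shortest, and rescale it by $n^{1-\alpha}$ in the horizontal direction and by $n^{\alpha}$ in the vertical direction (a point $(x,y)$ becomes $(x/n^{1-\alpha},\,y/n^{\alpha})$). Then for each $\varepsilon,\eta>0$ there exists an integer $n_0$ such that, for each $n\geq n_0$, with probability greater than $1-\varepsilon$, the border of the rescaled diagram $\lambda_n$ (the staircase curve going from the $y$-axis to the $x$-axis) is contained in the region which is the union of the three sets 1. $\{(x,y): 0\leq x\leq c(1-\eta/2),\ c^{-1}(1-\eta)\leq y\leq c^{-1}\}$; 2. $\{(x,y): x\geq 0,\ c(1-\eta/2)\leq x\leq c(1+\eta/2),\ 0\leq y\leq c^{-1}\}$; 3. $\{(x,y): x\geq c(1+\eta/2),\ 0\leq y\leq c^{-1}\eta\}$.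
   Context: The symmetric group $\mathfrak{S}_n$ acts on $(\mathbb{C}^N)^{\otimes n}$ by permuting the tensor factors. For a partition $\lambda$ of $n$ let $S_\lambda$ be the irreducible representation of $\mathfrak{S}_n$ indexed by $\lambda$ (Specht module) and $m_\lambda$ its multiplicity in $(\mathbb{C}^N)^{\otimes n}$. The Schur-Weyl measure of parameters $n$ and $N$ is the probability measure on partitions of size $n$ (identified with Young diagrams) given by $$\mathbb{P}[\lambda]=\frac{m_\lambda\cdot\dim(S_\lambda)}{N^n}.$$ It is the image of the uniform distribution on words of length $n$ with letters in $\{1,\dots,N\}$ under the map sending a word to the shape of its RSK tableaux.
   Formalization: In sets 1 and 2 the upper bound y ≤ c^{-1} is replaced by y ≤ max(c^{-1}, N_n/n^α), since the border starts at height N_n/n^α with high probability, which exceeds c^{-1} when N_n > c^{-1}n^α; the bound is literal whenever N_n ≤ c^{-1}n^α. *)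

(* Defs.v *)
From mathcomp Require Import all_boot all_order all_algebra all_fingroup.
From mathcomp Require Import mxrepresentation complex.
From mathcomp Require Import all_classical all_reals all_analysis.

Set Implicit Arguments.
Unset Strict Implicit.
Unset Printing Implicit Defensive.

Import Order.TTheory GRing.Theory Num.Theory.
Import numFieldNormedType.Exports.

Local Open Scope classical_set_scope.
Local Open Scope ring_scope.

(* A partition of n is padded with zeros to exactly n parts, which makes the
   partitions of n a finite type. *)
Definition is_partition (n : nat) (t : n.-tuple 'I_n.+1) : bool :=
  sorted geq (map val t) && (sumn (map val t) == n)%N.

Definition partition_of (n : nat) := {t : n.-tuple 'I_n.+1 | is_partition t}.

Definition parts (n : nat) (lam : partition_of n) : seq nat :=
  map val (val lam).

Definition part (n : nat) (lam : partition_of n) (k : nat) : nat :=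
  nth 0%N (parts lam) k.

Section Words.

Variables (F : fieldType) (n : nat) (T : finType).

Definition word := {ffun 'I_n -> T}.

(* The letter in position i is moved to position s i.  This is a right action
   because (s * t)%g maps i to t (s i). *)
Definition permute_word (w : word) (s : 'S_n) : word :=
  [ffun i => w (s^-1%g i)].

Definition word_vec (w : word) : 'rV[F]_#|{: word}| := delta_mx 0 (enum_rank w).

Definition word_mx (s : 'S_n) : 'M[F]_#|{: word}| :=
  \matrix_(i < #|{: word}|) word_vec (permute_word (enum_val i) s).

Lemma word_vecM (w : word) (s : 'S_n) :
  word_vec w *m word_mx s = word_vec (permute_word w s).
Proof. by rewrite /word_vec -rowE rowK enum_rankK. Qed.

Lemma word_mx_repr : mx_repr [set: 'S_n]%G word_mx.
Proof.
split=> [|s t _ _]; apply/row_matrixP => i.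
  rewrite rowK row1 /word_vec; congr (delta_mx 0 _).
  rewrite -[RHS]enum_valK; congr enum_rank.
  by apply/ffunP => k; rewrite ffunE invg1 perm1.
rewrite row_mul !rowK word_vecM; congr word_vec.
by apply/ffunP => k; rewrite !ffunE invMg permM.
Qed.

(* The space of functions on words is the n-th tensor power of the space F^T:
   the word w stands for the basis tensor e_(w 0) (x) ... (x) e_(w (n-1)), and
   the symmetric group permutes the tensor factors. *)
Definition word_repr : mx_representation F [set: 'S_n]%G #|{: word}| :=
  MxRepresentation word_mx_repr.

End Words.

Section Specht.

Variables (F : fieldType) (n : nat) (lam : partition_of n).

(* The tableau of shape lam filled with 0, ..., n-1 row after row: the entry i
   lies in row tab_row i and column tab_col i. *)
Definition tab_row (i : 'I_n) : 'I_n := insubd i (reshape_index (parts lam) i).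

Definition tab_col (i : 'I_n) : nat := reshape_offset (parts lam) i.

Definition column_preserving (s : 'S_n) : bool :=
  [forall i, tab_col (s i) == tab_col i].

(* The tabloid of a tableau is encoded as the word whose i-th letter is the row
   containing the entry i. *)
Definition tabloid : word n 'I_n := [ffun i => tab_row i].

Definition polytabloid : 'rV[F]_#|{: word n 'I_n}| :=
  \sum_(s : 'S_n | column_preserving s)
    (-1) ^+ s *: word_vec F (permute_word tabloid s).

(* The Specht module is spanned by the polytabloids of all tableaux of shape
   lam, that is by the images of a single one under the symmetric group. *)
Definition specht_mx : 'M[F]_#|{: word n 'I_n}| :=
  cyclic_mx (word_repr F n 'I_n) polytabloid.

Definition specht_repr : mx_representation F [set: 'S_n]%G (\rank specht_mx) :=
  submod_repr (cyclic_mx_module (word_repr F n 'I_n) polytabloid).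

End Specht.

(* The multiplicity in rV of the irreducible representation rS: the sum has at
   most one term, as the isotypic components of rV are pairwise non-isomorphic.
 *)
Definition multiplicity (F : decFieldType) (gT : finGroupType) (G : {group gT})
    (m d : nat) (rV : mx_representation F G m) (rS : mx_representation F G d) :
    nat :=
  \sum_(W : DecSocleType rV | `[< mx_rsim (socle_repr W) rS >]) socle_mult W.

Section SchurWeyl.

Variable R : realType.

Definition schur_weyl_mass (n N : nat) (lam : partition_of n) : R :=
  (multiplicity (word_repr R[i] n 'I_N) (specht_repr R[i] lam)
     * \rank (specht_mx R[i] lam))%N%:R / N%:R ^+ n.

Definition schur_weyl_prob (n N : nat) (A : set (partition_of n)) : R :=
  \sum_(lam : partition_of n | `[< A lam >]) schur_weyl_mass N lam.

(* The row k occupies the strip k <= y <= k + 1; each nonempty row contributes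
   its right side and the part of its top side not covered by the next row. *)
Definition border (n : nat) (lam : partition_of n) : set (R * R) :=
  [set p | exists k : nat, (0 < part lam k)%N /\
    ((p.1 = (part lam k)%:R /\ k%:R <= p.2 <= k.+1%:R) \/
     ((part lam k.+1)%:R <= p.1 <= (part lam k)%:R /\ p.2 = k.+1%:R))].

Definition rescaled_border (alpha : R) (n : nat) (lam : partition_of n) :
    set (R * R) :=
  [set (p.1 / n%:R `^ (1 - alpha), p.2 / n%:R `^ alpha) | p in border lam].

(* The limiting height is h = c^-1, but the border starts at height
   (number of rows) / n^alpha, which for N_n > c^-1 n^alpha may exceed it. *)
Definition limit_region (c eta h : R) : set (R * R) :=
  [set p | 0 <= p.1 <= c * (1 - eta / 2) /\ c^-1 * (1 - eta) <= p.2 <= h]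
  `|` [set p | 0 <= p.1 /\ c * (1 - eta / 2) <= p.1 <= c * (1 + eta / 2) /\
               0 <= p.2 <= h]
  `|` [set p | c * (1 + eta / 2) <= p.1 /\ 0 <= p.2 <= c^-1 * eta].

End SchurWeyl.

(* Main.v *)
Require Import Defs.
From mathcomp Require Import all_boot all_order all_algebra all_fingroup.
From mathcomp Require Import pgroup mxrepresentation complex.
From mathcomp Require Import zify ring lra.
From mathcomp Require Import all_classical all_reals all_analysis.

Set Implicit Arguments.
Unset Strict Implicit.
Unset Printing Implicit Defensive.

Import Order.TTheory GRing.Theory Num.Theory.
Import numFieldNormedType.Exports.

(** The Casimir-type element Z, the sum of all transpositions (x y) over the
    ordered pairs (x, y), fixed pairs included, controls the second moment of
    the row lengths.  On the Specht module of lam it is the scalar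
    sum_k lam_k^2 - C(lam), where C(lam) counts the ordered pairs of distinct
    cells in a common column ([tperm_sum_specht]).  The trace of a
    transposition on words is N^(n-1).  Hence, as soon as the word
    representation is known to be the sum of the Specht modules with their
    multiplicities ([multiplicity_trace]), comparing traces gives
      E[sum_k lam_k^2] = n + n(n-1)/N + E[C(lam)].
    Only diagrams with at most N rows have positive mass ([mass_rows]), so
    C(lam) <= n(N-1), and therefore
      E[sum_(k<N) (lam_k - n/N)^2] <= nN    ([mean_row_deviation]).

    If the border leaves the region, then at least a proportion eta/2 of the N
    rows have a length that differs from n/N by at least (eta/4) n/N
    ([border_region]); the sum of squares is then of order n^2/N, and by
    Markov's inequality this has probability O(N^2/n) = O(n^(2 alpha - 1)),
    which tends to 0 because alpha < 1/2.

    The representation theory needed for the decomposition is the following.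
    A word which is not killed by the column symmetrizer of lam has distinct
    letters in each column; counting small letters column by column shows that
    its content is dominated by lam, with equality only for the column
    rearrangements of the tabloid of lam ([column_injective_dominated],
    [column_injective_cell]).  This makes the symmetrizer a rank one operator
    on the module generated by the tabloid, so Specht modules are simple, and
    it separates different diagrams ([specht_simple], [specht_rsim_inj]).
    Permutations with the same cycle type are conjugate, so there are at most
    as many irreducible representations as partitions, and the Specht modules
    exhaust them ([card_classes_le_partitions], [specht_complete]). *)

(** * Cells of a Young diagram *)

Lemma geq_transitive : transitive geq.
Proof. by move=> a b c ba ca; apply: leq_trans ca ba. Qed.

Section Tableau.
Variables (n : nat) (lam : partition_of n).
Local Notation row := (tab_row lam).
Local Notation col := (tab_col lam).

Lemma size_parts : size (parts lam) = n.
Proof. by rewrite size_map size_tuple. Qed.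

Lemma sumn_parts : sumn (parts lam) = n.
Proof. by case/andP: (valP lam) => _ /eqP. Qed.

Lemma part_le i j : i <= j -> part lam j <= part lam i.
Proof.
move=> ij; have [jn|nj] := ltnP j n;
  last by rewrite /part nth_default ?size_parts.
case/andP: (valP lam) => srt _.
apply: (sorted_leq_nth geq_transitive leqnn 0 srt) => //;
  rewrite inE size_map size_tuple //.
exact: leq_ltn_trans ij jn.
Qed.

Lemma part_leq_n i : part lam i <= n.
Proof.
have [jn|nj] := ltnP i n; last by rewrite /part nth_default ?size_parts.
rewrite /part /parts (nth_map ord0) ?size_tuple //.
by rewrite -ltnS ltn_ord.
Qed.

Lemma tab_rowE i : row i = reshape_index (parts lam) i :> nat.
Proof.
rewrite /tab_row val_insubd ifT //.
by rewrite -[X in _ < X]size_parts reshape_indexP // sumn_parts.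
Qed.

Lemma tab_col_lt i : col i < part lam (row i).
Proof. by rewrite tab_rowE; apply: reshape_offsetP; rewrite sumn_parts. Qed.

Lemma tab_col_ltn i : col i < n.
Proof. exact: leq_trans (tab_col_lt i) (part_leq_n _). Qed.

Lemma tab_inj i j : row i = row j -> col i = col j -> i = j.
Proof.
move=> rij cij; apply: val_inj => /=.
rewrite -(reshape_indexK (parts lam) i) -(reshape_indexK (parts lam) j).
by rewrite -!tab_rowE rij; congr flatten_index.
Qed.

Lemma tab_surj r c : c < part lam r -> exists2 i, row i = r :> nat & col i = c.
Proof.
move=> cr; have := flatten_indexP cr; rewrite sumn_parts => lt.
exists (Ordinal lt); first by rewrite tab_rowE /= flatten_indexKl.
by rewrite /tab_col /= flatten_indexKr.
Qed.

Lemma card_tab_row r : #|[pred i | row i == r :> nat]| = part lam r.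
Proof.
have [|npos] := posnP (part lam r).
  move=> p0; rewrite p0; apply: eq_card0 => i; rewrite !inE.
  by apply/eqP => ri; have := tab_col_lt i; rewrite ri p0.
rewrite -[RHS]card_ord -(card_in_imset
  (f := fun i => inord (col i) : 'I_(part lam r).-1.+1)).
  rewrite -(prednK npos) -[in RHS]cardsT; apply: eq_card => c; rewrite !inE.
  have cr : c < part lam r by rewrite -[X in _ < X](prednK npos).
  apply/imsetP; have [i ri ci] := tab_surj cr.
  by exists i; rewrite ?inE ?ri //; apply: val_inj; rewrite /= ci inordK.
move=> i j; rewrite !inE => /eqP ri /eqP rj /(congr1 val) /=.
rewrite !inordK ?prednK //; first last.
- by rewrite -ri tab_col_lt.
- by rewrite -rj tab_col_lt.
move=> cij.
by apply: tab_inj => //; apply: val_inj; rewrite /= ri rj.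
Qed.

Lemma tab_above i r : r <= row i -> exists2 j, row j = r :> nat & col j = col i.
Proof. by move=> ri; apply/tab_surj/(leq_trans (tab_col_lt i))/part_le. Qed.

Definition column_injective (T : Type) (w : 'I_n -> T) :=
  forall i j, col i = col j -> w i = w j -> i = j.

(** If the column reaches row k, then its first k cells account for k on the
    right, and distinct letters below k number at most k; otherwise the whole
    column is counted on the right. *)
Lemma column_count (w : 'I_n -> nat) c k : column_injective w ->
  #|[pred i | (col i == c) && (w i < k)]|
    <= #|[pred i | (col i == c) && (row i < k)]|.
Proof.
move=> w_inj.
have [/existsP[i0 /andP[/eqP ci0 ri0]]|] :=
  boolP [exists i, (col i == c) && (k <= row i)].
  apply: (@leq_trans k).
    case: k ri0 => [_|k ri0]; first by rewrite eq_card0 // => i;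
      rewrite !inE ltn0 andbF.
    rewrite -[X in _ <= X]card_ord.
    rewrite -(card_in_imset (f := fun i => inord (w i) : 'I_k.+1)) ?max_card //.
    move=> i j;
      rewrite !inE => /andP[/eqP ci wi] /andP[/eqP cj wj] /(congr1 val) /=.
    by rewrite !inordK //; apply: w_inj; rewrite ci cj.
  have cell (r : 'I_k) : exists i, (col i == c) && (row i == r :> nat).
    have [|j rj cj] := @tab_above i0 r;
      first exact: leq_trans (ltnW (ltn_ord r)) ri0.
    by exists j; rewrite cj ci0 rj !eqxx.
  rewrite -[X in X <= _]card_ord -(card_imset (f := fun r : 'I_k => xchoose (cell r))).
    apply/subset_leq_card/fintype.subsetP => i /imsetP[r _ ->]; rewrite inE.
    by case/andP: (xchooseP (cell r)) => -> /eqP ->; rewrite ltn_ord.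
  move=> r s rs; apply: val_inj => /=.
  case/andP: (xchooseP (cell r)) => _ /eqP <-.
  by case/andP: (xchooseP (cell s)) => _ /eqP <-; rewrite rs.
rewrite negb_exists => /forallP row_lt.
apply/subset_leq_card/fintype.subsetP => i; rewrite !inE => /andP[ci _];
  rewrite ci /=.
by have := row_lt i; rewrite ci /= -ltnNge.
Qed.

Lemma count_by_column (P : pred 'I_n) :
  #|P| = \sum_(c < n) #|[pred i | (col i == c) && P i]|.
Proof.
rewrite -sum1_card (partition_big (fun i => Ordinal (tab_col_ltn i)) xpredT) //=.
apply: eq_bigr => c _; rewrite -sum1_card; apply: eq_bigl => i.
by rewrite !inE andbC.
Qed.

(** This is the dominance order on contents, in terms of partial sums. *)
Lemma column_injective_dominated (w : 'I_n -> nat) k : column_injective w ->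
  #|[pred i | w i < k]| <= #|[pred i | row i < k]|.
Proof.
move=> w_inj; rewrite count_by_column [leqRHS]count_by_column.
by apply: leq_sum => c _; apply: column_count.
Qed.

(** In the tight case the counts agree in every column, so the letters of a
    column are the rows of its cells.  The cell found here is where a column
    permutation turning w into the tabloid must send i. *)
Lemma column_injective_cell (w : 'I_n -> nat) : column_injective w ->
    (forall k, #|[pred i | w i < k]| = #|[pred i | row i < k]|) ->
  forall i, exists2 j, col j = col i & row j = w i :> nat.
Proof.
move=> w_inj w_cnt i.
have tight k : #|[pred j | (col j == col i) && (w j < k)]| =
               #|[pred j | (col j == col i) && (row j < k)]|.
  pose A c := #|[pred j | (col j == c) && (w j < k)]|.
  pose B c := #|[pred j | (col j == c) && (row j < k)]|.
  have AB c : A c <= B c ?= iff (A c == B c) by split=> //; apply: column_count.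
  have /eqP : \sum_(c < n) A c = \sum_(c < n) B c.
    by have := w_cnt k; rewrite count_by_column [RHS]count_by_column.
  rewrite (leqif_sum (fun (c : 'I_n) (_ : true) => AB c)).
  by move/forallP/(_ (Ordinal (tab_col_ltn i)))/eqP.
have [/existsP[j /andP[/eqP cj /eqP rj]]|] :=
  boolP [exists j, (col j == col i) && (row j == w i :> nat)].
  by exists j.
rewrite negb_exists => /forallP none.
(* Without a cell in row w i the count on the right is the same for the bounds
   w i and (w i).+1, while the count on the left increases because of i. *)
have /eqP := tight (w i).+1; rewrite eqn_leq => /andP[+ _];
  rewrite leqNgt => /negP[].
have -> : #|[pred j | (col j == col i) && (row j < (w i).+1)]| =
          #|[pred j | (col j == col i) && (row j < w i)]|.
  apply: eq_card => j; rewrite !inE ltnS leq_eqVlt.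
  by have := none j; case: (col j == col i) => //= /negPf ->.
rewrite -tight; apply/proper_card/properP; split.
  by apply/fintype.subsetP => j; rewrite !inE => /andP[-> /leqW].
by exists i; rewrite !inE eqxx /= ?ltnn.
Qed.

End Tableau.

Lemma partition_eq n (lam mu : partition_of n) :
  part lam =1 part mu -> lam = mu.
Proof.
move=> eq_part; apply/val_inj/val_inj => /=.
apply: (inj_map val_inj).
apply: (@eq_from_nth _ 0); first by rewrite !size_map !size_tuple.
by move=> i _; apply: eq_part.
Qed.

(** Dominance in both directions amounts to the equality of these counts. *)
Lemma partition_eq_count n (lam mu : partition_of n) :
    (forall k, #|[pred i | tab_row lam i < k]| = #|[pred i | tab_row mu i < k]|) ->
  lam = mu.
Proof.
move=> eq_cnt; apply: partition_eq => r; rewrite -!card_tab_row.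
have split_row (nu : partition_of n) : #|[pred i | tab_row nu i < r.+1]| =
    #|[pred i | tab_row nu i < r]| + #|[pred i | tab_row nu i == r :> nat]|.
  rewrite -!sum1_card (bigID [pred i | tab_row nu i < r]) /=; congr (_ + _).
    by apply: eq_bigl => i; rewrite !inE ltnS; apply/andb_idl/ltnW.
  by apply: eq_bigl => i; rewrite !inE ltnS -leqNgt -eqn_leq.
by have := eq_cnt r.+1; rewrite !split_row eq_cnt => /addnI.
Qed.

(** * Conjugacy classes of the symmetric group *)

Section MatchCycles.
Variable (T : eqType).
Implicit Types (s t : T -> T) (c d : seq T) (cs ct : seq (seq T)).

Lemma fcycle_next s c x : fcycle s c -> x \in c -> s x = next c x.
Proof. by move=> cyc xc; apply/eqP/(next_cycle cyc xc). Qed.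

(** Both maps advance the index by one, cyclically. *)
Lemma match_cycle s t c d x0 x : size c = size d -> fcycle s c -> fcycle t d ->
    uniq c -> uniq d -> x \in c ->
  nth x0 d (index (s x) c) = t (nth x0 d (index x c)).
Proof.
move=> szcd cyc cyd uc ud xc.
have ic : index x c < size c by rewrite index_mem.
rewrite (fcycle_next cyc xc) (fcycle_next cyd) ?mem_nth -?szcd //.
rewrite !next_nth xc mem_nth -?szcd // index_uniq -?szcd //.
move: (index x c) ic => i; clear - szcd uc.
case: c d szcd uc => [|z c'] [|y d'] //= [szcd] /andP[zc' uc'] ic.
have [ic'|ic'] := ltnP i (size c').
  rewrite ifN; last by apply: contraNneq zc' => ->; rewrite mem_nth.
  rewrite index_uniq //=.
  by apply: set_nth_default; rewrite -szcd.
by rewrite [nth z c' i]nth_default ?eqxx /= ?nth_default -?szcd.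
Qed.

Lemma mem_flatten_fcycle s cs x :
  all (fcycle s) cs -> x \in flatten cs -> s x \in flatten cs.
Proof.
move=> /allP cyc /flattenP[c ccs xc]; apply/flattenP; exists c => //.
by rewrite (fcycle_next (cyc c ccs) xc) mem_next.
Qed.

Lemma match_cycles s t cs ct x0 x : shape cs = shape ct ->
    all (fcycle s) cs -> all (fcycle t) ct ->
    uniq (flatten cs) -> uniq (flatten ct) -> x \in flatten cs ->
  nth x0 (flatten ct) (index (s x) (flatten cs)) =
    t (nth x0 (flatten ct) (index x (flatten cs))).
Proof.
elim: cs ct => [|c cs IH] [|d ct] //= [szcd szs] /andP[cyc cycs] /andP[cyd cyct].
rewrite !cat_uniq => /and3P[uc disj ucs] /and3P[ud _ uct]; rewrite mem_cat.
have [xc _|xc /= xcs] := boolP (x \in c).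
  have sxc : s x \in c by rewrite (fcycle_next cyc xc) mem_next.
  rewrite !index_cat xc sxc !nth_cat -szcd !index_mem xc sxc.
  exact: match_cycle.
have sxcs := mem_flatten_fcycle cycs xcs.
have sxc : s x \notin c by apply: contraNN disj => sxc; apply/hasP;
  exists (s x).
rewrite !index_cat (negPf xc) (negPf sxc) !nth_cat -szcd !ltnNge !leq_addr /=.
by rewrite !addKn; apply: IH.
Qed.

Lemma uniq_flatten_map (I : eqType) (r : seq I) (f : I -> seq T) :
    uniq r -> {in r, forall i, uniq (f i)} ->
    (forall i j x, i \in r -> j \in r -> x \in f i -> x \in f j -> i = j) ->
  uniq (flatten (map f r)).
Proof.
elim: r => //= i r IH /andP[ir ur] uf disj; rewrite cat_uniq uf ?mem_head //=.
apply/andP; split.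
  apply/hasPn => x /flattenP[_ /mapP[j jr ->] xj].
  apply: contraNN ir => xi.
  by rewrite (disj i j x) ?mem_head // inE jr orbT.
apply: IH => // [j jr|j k x jr kr]; first by apply: uf; rewrite inE jr orbT.
by apply: disj; rewrite inE ?jr ?kr orbT.
Qed.

End MatchCycles.

Section CycleType.
Variable n : nat.
Implicit Types s t : 'S_n.

Definition cycles s : seq (seq 'I_n) :=
  sort (fun c d => size d <= size c) [seq fingraph.orbit s x | x <- enum (froots s)].

Lemma mem_cycles s c :
  c \in cycles s -> exists2 x, x \in froots s & c = fingraph.orbit s x.
Proof.
rewrite mem_sort => /mapP[x xr ->]; exists x => //.
by rewrite mem_enum in xr.
Qed.

Lemma cycles_fcycle s : all (fcycle s) (cycles s).
Proof.
apply/allP => c /mem_cycles[x _ ->]; apply: cycle_orbit; exact: perm_inj.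
Qed.

Lemma perm_flatten_cycles s : perm_eq (flatten (cycles s)) (enum 'I_n).
Proof.
apply: (@perm_trans _ (flatten [seq fingraph.orbit s x | x <- enum (froots s)])).
  by apply: perm_flatten; rewrite perm_sort.
have csym := fconnect_sym (@perm_inj _ s).
apply: uniq_perm; rewrite ?enum_uniq //.
  apply: uniq_flatten_map; rewrite ?enum_uniq // => x y z.
  rewrite !mem_enum -!fconnect_orbit => /eqP rx /eqP ry xz yz.
  rewrite -rx -ry; apply/(fingraph.rootP csym); by apply: connect_trans xz _;
    rewrite csym.
move=> x; rewrite mem_enum; apply/flattenP;
  exists (fingraph.orbit s (froot s x)).
  by apply: map_f; rewrite mem_enum; apply: roots_root.
by rewrite -fconnect_orbit csym connect_root.
Qed.

Lemma uniq_flatten_cycles s : uniq (flatten (cycles s)).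
Proof. by rewrite (perm_uniq (perm_flatten_cycles s)) enum_uniq. Qed.

Lemma mem_flatten_cycles s x : x \in flatten (cycles s).
Proof. by rewrite (perm_mem (perm_flatten_cycles s)) mem_enum. Qed.

Lemma size_flatten_cycles s : size (flatten (cycles s)) = n.
Proof. by rewrite (perm_size (perm_flatten_cycles s)) size_enum_ord. Qed.

(** The conjugating permutation matches the concatenated cycle lists entry by
    entry. *)
Lemma conj_cycles s t :
  shape (cycles s) = shape (cycles t) -> exists p, (s ^ p)%g = t.
Proof.
move=> shst.
pose f x := nth x (flatten (cycles t)) (index x (flatten (cycles s))).
have f_lt x : index x (flatten (cycles s)) < size (flatten (cycles t)).
  rewrite size_flatten_cycles -[X in _ < X](size_flatten_cycles s).
  by rewrite index_mem mem_flatten_cycles.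
have fE x0 x : f x = nth x0 (flatten (cycles t)) (index x (flatten (cycles s))).
  exact: set_nth_default.
have f_inj : injective f.
  move=> x y; rewrite (fE x x) (fE x y) => /eqP.
  rewrite nth_uniq ?uniq_flatten_cycles // => /eqP.
  exact: (index_inj x (mem_flatten_cycles s x) (mem_flatten_cycles s y)).
exists (perm f_inj); apply/permP => y.
rewrite -{1}(permKV (perm f_inj) y) permJ permE (fE y).
rewrite (match_cycles (t := t)) ?cycles_fcycle ?uniq_flatten_cycles
  ?mem_flatten_cycles //.
by rewrite -fE -[f _](permE f_inj) permKV.
Qed.

Lemma shape_cycles_gt0 s : all (fun k => 0 < k) (shape (cycles s)).
Proof.
apply/allP => _ /mapP[c /mem_cycles[x _ ->] ->].
by rewrite fingraph.size_orbit fingraph.order_gt0.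
Qed.

Lemma sumn_shape_cycles s : sumn (shape (cycles s)) = n.
Proof. by rewrite -size_flatten size_flatten_cycles. Qed.

Definition padded_shape s := shape (cycles s) ++ nseq (n - size (cycles s)) 0.

Lemma size_padded_shape s : size (padded_shape s) == n.
Proof.
rewrite size_cat size_nseq size_map subnKC //.
rewrite -[leqRHS](sumn_shape_cycles s) -[size (cycles s)](size_map size) -/(shape _).
elim: (shape _) (shape_cycles_gt0 s) => //= k ks IH /andP[k0 /IH].
by rewrite -add1n; apply: leq_add.
Qed.

Lemma mem_padded_shape s k : k \in padded_shape s -> k < n.+1.
Proof.
move=> ks; rewrite ltnS; have <- : sumn (padded_shape s) = n.
  by rewrite sumn_cat sumn_nseq mul0n addn0 sumn_shape_cycles.
elim: (padded_shape s) ks => //= m ms IH; rewrite inE => /predU1P[->|/IH le].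
  exact: leq_addr.
exact: leq_trans le (leq_addl _ _).
Qed.

Definition cycle_tuple s : n.-tuple 'I_n.+1 :=
  map_tuple inord (Tuple (size_padded_shape s)).

Lemma cycle_tupleE s : map val (cycle_tuple s) = padded_shape s.
Proof.
rewrite /= -map_comp -[RHS]map_id; apply/eq_in_map => k /mem_padded_shape kn /=.
by rewrite inordK.
Qed.

Lemma cycle_tuple_partition s : is_partition (cycle_tuple s).
Proof.
rewrite /is_partition cycle_tupleE sumn_cat sumn_nseq mul0n addn0.
rewrite sumn_shape_cycles eqxx andbT /padded_shape.
rewrite (sorted_pairwise geq_transitive) pairwise_cat -(sorted_pairwise geq_transitive).
apply/and3P; split.
- by apply/allrelP => a b _ /nseqP[-> _].
- rewrite sorted_map; apply: sort_sorted => c d.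
  by rewrite /= leq_total.
- by elim: (n - _) => //= m ->; rewrite andbT all_nseq /= orbT.
Qed.

Definition cycle_type s : partition_of n :=
  Sub (cycle_tuple s) (cycle_tuple_partition s).

(** Cycle lengths are positive, so they are recovered from the padded list. *)
Lemma cycle_type_conj s t :
  cycle_type s = cycle_type t -> exists p, (s ^ p)%g = t.
Proof.
move/(congr1 val)=> /= /(congr1 (fun u => map val (tval u))).
rewrite !cycle_tupleE => /(congr1 (seq.filter (fun k => 0 < k))).
have filtE u : seq.filter (fun k => 0 < k) (padded_shape u) = shape (cycles u).
  rewrite filter_cat filter_nseq /= cats0.
  exact/all_filterP/shape_cycles_gt0.
by rewrite !filtE; apply: conj_cycles.
Qed.

Lemma card_classes_le_partitions :
  #|classes [set: 'S_n]| <= #|{: partition_of n}|.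
Proof.
rewrite -(card_in_imset (f := fun C : {set 'S_n} => cycle_type (repr C))) ?max_card //.
move=> _ _ /imsetP[s _ ->] /imsetP[t _ ->].
have [u _ ->] := repr_class [set: 'S_n] s;
  have [v _ ->] := repr_class [set: 'S_n] t.
case/cycle_type_conj=> p stp.
have -> : t = (s ^ (u * p * v^-1))%g by rewrite !conjgM stp conjgK.
by rewrite classGidl ?inE.
Qed.

End CycleType.

Local Open Scope ring_scope.

(** * Column symmetrizers and Specht modules *)

Lemma pchar0_pgroup (F : fieldType) (gT : finGroupType) (G : {group gT}) :
  [pchar F] =i pred0 -> ([pchar F]^').-group%g G.
Proof.
by move=> pchar0; apply: sub_pgroup (pgroup_pi _) => p _; rewrite inE /= pchar0.
Qed.

Section Words.
Variables (n : nat) (T : finType).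
Implicit Types (w : word n T) (s t : 'S_n).

Lemma permute_wordE w s i : permute_word w s i = w (s^-1%g i).
Proof. by rewrite ffunE. Qed.

Lemma permute_wordK w s i : permute_word w s (s i) = w i.
Proof. by rewrite permute_wordE permK. Qed.

Lemma permute_word1 w : permute_word w 1%g = w.
Proof. by apply/ffunP=> i; rewrite permute_wordE invg1 perm1. Qed.

Lemma count_permute_word (P : pred T) w s :
  #|[pred i | P (permute_word w s i)]| = #|[pred i | P (w i)]|.
Proof.
rewrite -!sum1_card (reindex_inj (@perm_inj _ s)).
by apply: eq_bigl => i; rewrite !inE permute_wordK.
Qed.

End Words.

Section ColumnSymmetrizer.
Variables (F : fieldType) (n : nat) (lam : partition_of n) (T : finType).
Local Notation col := (tab_col lam).
Local Notation colp := (column_preserving lam).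

Lemma column_preservingP (s : 'S_n) :
  reflect (forall i, col (s i) = col i) (colp s).
Proof. exact: 'forall_eqP. Qed.

Lemma column_preserving1 : colp 1%g.
Proof. by apply/column_preservingP=> i; rewrite perm1. Qed.

Lemma column_preservingMr s t : colp t -> colp (s * t)%g = colp s.
Proof.
move/column_preservingP=> Ct.
by apply: eq_forallb => i; rewrite permM Ct.
Qed.

Lemma column_preservingV s : colp s -> colp s^-1%g.
Proof.
by move=> Cs; rewrite -(column_preservingMr _ Cs) mulVg column_preserving1.
Qed.

Lemma column_preservingMl s t : colp s -> colp (s * t)%g = colp t.
Proof.
move=> Cs; apply/idP/idP=> Ct; last by rewrite column_preservingMr.
rewrite -[t](mulKg s); rewrite column_preservingMr //.
exact: column_preservingV.
Qed.

Lemma column_preserving_tperm i j : col i = col j -> colp (tperm i j).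
Proof.
by move=> cij; apply/column_preservingP=> k; case: tpermP => // ->.
Qed.

(** The letters may be of any type T: the same signed sum acts on the words
    that carry the Specht module and on the words over 'I_N. *)
Definition column_symmetrizer : 'M[F]_#|{: word n T}| :=
  \sum_(s : 'S_n | colp s) (-1) ^+ s *: word_mx F T s.
Local Notation kappa := column_symmetrizer.

Lemma word_mxM (s t : 'S_n) :
  word_mx F T s *m word_mx F T t = word_mx F T (s * t)%g.
Proof. by have [_ ->] := word_mx_repr F n T; rewrite ?inE. Qed.

Lemma column_symmetrizerMl s : colp s ->
  word_mx F T s *m kappa = (-1) ^+ s *: kappa.
Proof.
move=> Cs; rewrite /kappa mulmx_sumr scaler_sumr.
rewrite [RHS](reindex_inj (mulgI s)) /=.
apply: eq_big => [t|t Ct]; first by rewrite column_preservingMl.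
by rewrite -scalemxAr word_mxM scalerA odd_permM signr_addb
  mulrA -expr2 sqrr_sign mul1r.
Qed.

Lemma column_symmetrizer_sqr :
  kappa *m kappa = #|[pred s | colp s]|%:R *: kappa.
Proof.
rewrite {1}/kappa mulmx_suml -[(#|[pred s | colp s]|)]sum1_card natr_sum scaler_suml.
apply: eq_bigr => s Cs; rewrite -scalemxAl column_symmetrizerMl // scalerA.
by rewrite -expr2 sqrr_sign.
Qed.

Lemma column_symmetrizer_mxmodule m (U : 'M[F]_(m, #|{: word n T}|)) :
  mxmodule (word_repr F n T) U -> (U *m kappa <= U)%MS.
Proof.
move/mxmoduleP=> modU; rewrite mulmx_sumr; apply: summx_sub => s _.
by rewrite -scalemxAr scalemx_sub // (modU s) ?inE.
Qed.

Hypothesis pchar0 : [pchar F] =i pred0.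

(** A transposition of two equal letters in a common column fixes the word and
    changes the sign of the symmetrizer. *)
Lemma column_symmetrizer_neq0 (w : word n T) :
  word_vec F w *m kappa != 0 -> column_injective lam w.
Proof.
move=> nz i j cij wij; apply: contraNeq nz => nij.
have Cij := column_preserving_tperm cij.
have fixw : permute_word w (tperm i j) = w.
  apply/ffunP=> k; rewrite permute_wordE tpermV.
  by case: tpermP => [->|->|//]; rewrite wij.
have : word_vec F w *m kappa = - (word_vec F w *m kappa).
  rewrite -{1}fixw -word_vecM -mulmxA column_symmetrizerMl //.
  by rewrite odd_tperm nij expr1 scaleN1r mulmxN.
move/eqP; rewrite -addr_eq0 -mulr2n -scaler_nat scaler_eq0.
by have /pcharf0P -> := pchar0.
Qed.

End ColumnSymmetrizer.

Section Specht.
Variables (F : fieldType) (n : nat) (lam : partition_of n).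
Hypothesis pchar0 : [pchar F] =i pred0.
Local Notation rowT := (tab_row lam).
Local Notation col := (tab_col lam).
Local Notation colp := (column_preserving lam).
Local Notation kappa := (column_symmetrizer F lam).
Local Notation e := (polytabloid F lam).
Local Notation rG := (word_repr F n 'I_n).

Lemma polytabloidE : e = word_vec F (tabloid lam) *m kappa 'I_n.
Proof.
rewrite /polytabloid /column_symmetrizer mulmx_sumr; apply: eq_bigr => s _.
by rewrite -scalemxAr word_vecM.
Qed.

Definition column_order : F := #|[pred s | colp s]|%:R.

Lemma column_order_neq0 : column_order != 0.
Proof.
rewrite /column_order; have /pcharf0P -> := pchar0.
by rewrite -lt0n; apply/card_gt0P; exists 1%g; rewrite inE column_preserving1.
Qed.

Lemma polytabloid_sym : e *m kappa 'I_n = column_order *: e.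
Proof. by rewrite polytabloidE -mulmxA column_symmetrizer_sqr scalemxAr. Qed.

Lemma polytabloid_neq0 : e != 0.
Proof.
apply/eqP=> /rowP/(_ (enum_rank (tabloid lam))); apply/eqP.
rewrite !mxE summxE (bigD1 1%g) ?column_preserving1 //=.
rewrite permute_word1 odd_perm1 expr0 scale1r big1 ?addr0.
  by rewrite /word_vec mxE !eqxx oner_eq0.
move=> s /andP[Cs s1]; rewrite !mxE eqxx /=.
case: eqP => [/enum_rank_inj fixt|_]; last by rewrite mulr0.
case/negP: s1; apply/eqP/permP=> i; rewrite perm1.
apply: (@tab_inj _ lam); last exact: (column_preservingP _ _ Cs).
by have /ffunP/(_ (s i)) := fixt; rewrite permute_wordK !ffunE => ->.
Qed.

(** The words involved here are all those of content mu. *)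
Lemma tabloid_dominance (mu : partition_of n) s k :
    word_vec F (permute_word (tabloid mu) s) *m kappa 'I_n != 0 ->
  (#|[pred i | tab_row mu i < k]| <= #|[pred i | rowT i < k]|)%N.
Proof.
move/(column_symmetrizer_neq0 pchar0) => winj.
have := column_injective_dominated (w := fun i => permute_word (tabloid mu) s i) k.
rewrite (count_permute_word [pred r : 'I_n | (r < k)%N]) => le.
have -> : #|[pred i | (tab_row mu i < k)%N]| =
  #|[pred i | [pred r : 'I_n | (r < k)%N] (tabloid mu i)]|.
  by apply: eq_card => i; rewrite !inE ffunE.
by apply: le => i j cij /val_inj; apply: winj.
Qed.

(** The symmetrizer has rank one on the words of content lam: the words that it
    does not kill are column rearrangements of the tabloid. *)
Lemma tabloid_symmetrizer s :
  (word_vec F (permute_word (tabloid lam) s) *m kappa 'I_n <= e)%MS.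
Proof.
have [->|nz] := eqVneq (word_vec F (permute_word (tabloid lam) s) *m kappa 'I_n) 0.
  exact: sub0mx.
have winj := column_symmetrizer_neq0 pchar0 nz.
set w := permute_word (tabloid lam) s in nz winj *.
have wcnt k : #|[pred i | (w i < k)%N]| = #|[pred i | (rowT i < k)%N]|.
  rewrite (count_permute_word [pred r : 'I_n | (r < k)%N]).
  by apply: eq_card => i; rewrite !inE ffunE.
have winj' : column_injective lam (fun i => w i : nat).
  by move=> i j cij /val_inj; apply: winj.
have cell i : exists j, (col j == col i) && (rowT j == w i).
  have [j cj rj] := column_injective_cell winj' wcnt i.
  by exists j; rewrite cj eqxx; apply/eqP/val_inj.
(* f moves each cell, within its column, to the row given by its letter. *)
pose f i := xchoose (cell i).
have fP i : col (f i) = col i /\ rowT (f i) = w i.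
  by case/andP: (xchooseP (cell i)) => /eqP ? /eqP ?.
have f_inj : injective f.
  move=> i j fij; apply: winj; first by rewrite -(fP i).1 -(fP j).1 fij.
  by rewrite -(fP i).2 -(fP j).2 fij.
pose u := (perm f_inj)^-1%g.
have Cu : colp u.
  by apply/column_preservingV/column_preservingP=> i; rewrite permE (fP i).1.
have -> : w = permute_word (tabloid lam) u.
  by apply/ffunP=> i;
    rewrite [RHS]permute_wordE invgK permE [RHS]ffunE (fP i).2.
rewrite -word_vecM -mulmxA column_symmetrizerMl // -scalemxAr -polytabloidE.
exact: scalemx_sub.
Qed.

Lemma cyclic_tabloidP (mu : partition_of n) (v : 'rV[F]_#|{: word n 'I_n}|) :
    (v <= cyclic_mx rG (word_vec F (tabloid mu)))%MS ->
  exists a : 'S_n -> F,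
    v = \sum_s a s *: word_vec F (permute_word (tabloid mu) s).
Proof.
case/cyclic_mxP=> A /envelop_mxP[a ->] ->; exists a.
rewrite mulmx_sumr; apply: eq_big => [s|s _]; first by rewrite inE.
by rewrite -scalemxAr word_vecM.
Qed.

Lemma specht_sub_cyclic :
  (specht_mx F lam <= cyclic_mx rG (word_vec F (tabloid lam)))%MS.
Proof.
rewrite cyclic_mx_sub ?cyclic_mx_module // polytabloidE.
apply: submx_trans (submxMr _ (cyclic_mx_id rG _)) _.
exact/column_symmetrizer_mxmodule/cyclic_mx_module.
Qed.

Lemma specht_symmetrizer m (U : 'M[F]_(m, #|{: word n 'I_n}|)) :
  (U <= specht_mx F lam)%MS -> (U *m kappa 'I_n <= e)%MS.
Proof.
move=> sU; apply/row_subP=> i; rewrite row_mul.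
have /cyclic_tabloidP[a ->] : (row i U <= cyclic_mx rG (word_vec F (tabloid lam)))%MS.
  exact: submx_trans (row_sub i U) (submx_trans sU specht_sub_cyclic).
rewrite mulmx_suml; apply: summx_sub => s _.
by rewrite -scalemxAl scalemx_sub // tabloid_symmetrizer.
Qed.

(** Split the Specht module as U + W.  The symmetrizer maps each summand into
    the line of the polytabloid e, so a summand which it does not kill contains
    e, and is everything.  It cannot kill both, as it multiplies e by the order
    of the column group. *)
Lemma specht_simple : mxsimple rG (specht_mx F lam).
Proof.
have modS := cyclic_mx_module rG e.
have Se := cyclic_mx_id rG e.
split; rewrite ?cyclic_mx_eq0 ?polytabloid_neq0 // => U modU sUS nzU.
have pgr := pchar0_pgroup [set: 'S_n]%G pchar0.
have [W modW defS dxUW] :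
    mxsplits rG (specht_mx F lam) U.
  apply: (mx_reducibleS modS (submx1 _) _ modU sUS).
  exact: mx_Maschke_pchar.
have full V : mxmodule rG V -> (V <= specht_mx F lam)%MS ->
    V *m kappa 'I_n != 0 ->
    (specht_mx F lam <= V)%MS.
  move=> modV sVS nz; apply: cyclic_mx_sub => //.
  apply: submx_trans (column_symmetrizer_mxmodule lam modV).
  have sVe := specht_symmetrizer sVS.
  rewrite -(geq_leqif (mxrank_leqif_sup sVe)).
  by apply: (leq_trans (rank_leq_row _)); rewrite lt0n mxrank_eq0.
have sWS : (W <= specht_mx F lam)%MS by rewrite -defS addsmxSr.
have [U0|] := eqVneq (U *m kappa 'I_n) 0; last exact: full.
have [W0|nzW] := eqVneq (W *m kappa 'I_n) 0.
  have : (e <= U + W)%MS by rewrite defS.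
  case/sub_addsmxP=> -[a b] /= eab.
  have := polytabloid_sym; rewrite {1}eab mulmxDl -!mulmxA U0 W0 !mulmx0 addr0.
  move/esym/eqP; rewrite scaler_eq0 (negPf column_order_neq0).
  by rewrite (negPf polytabloid_neq0).
have sUW : (U <= W)%MS := submx_trans sUS (full _ W modW sWS nzW).
case/negP: nzU; rewrite -submx0 -(mxdirect_addsP dxUW).
by rewrite sub_capmx submx_refl.
Qed.

Lemma specht_irr : mx_irreducible (specht_repr F lam).
Proof. exact/submod_mx_irr/specht_simple. Qed.

End Specht.

Section Occurrence.
Variables (F : fieldType) (n : nat) (lam : partition_of n) (T : finType).
Hypothesis pchar0 : [pchar F] =i pred0.

(** The polytabloid is an eigenvector of the symmetrizer for a nonzero
    eigenvalue, and an isomorphism preserves this. *)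
Lemma specht_occurs (U : 'M[F]_#|{: word n T}|)
    (modU : mxmodule (word_repr F n T) U) :
    mx_rsim (specht_repr F lam) (submod_repr modU) ->
  exists2 v : 'rV[F]_#|{: word n T}|,
    (v <= U)%MS & v *m column_symmetrizer F lam T != 0.
Proof.
case=> B eqr Bfree homB.
have modS := cyclic_mx_module (word_repr F n 'I_n) (polytabloid F lam).
have Se := cyclic_mx_id (word_repr F n 'I_n) (polytabloid F lam).
pose e' := in_submod (specht_mx F lam) (polytabloid F lam).
exists (val_submod (e' *m B)); first exact: val_submodP.
have -> : val_submod (e' *m B) *m column_symmetrizer F lam T =
    val_submod (in_submod (specht_mx F lam)
      (polytabloid F lam *m column_symmetrizer F lam 'I_n) *m B).
  rewrite /column_symmetrizer !mulmx_sumr [in RHS]linear_sum mulmx_suml linear_sum /=.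
  apply: eq_bigr => s _; rewrite -!scalemxAr !linearZ -scalemxAl linearZ /=.
  congr (_ *: _).
  rewrite -(val_submodJ modU) ?inE // -mulmxA -homB ?inE // mulmxA.
  by rewrite -(in_submodJ modS).
rewrite polytabloid_sym linearZ -scalemxAl linearZ scaler_eq0.
rewrite (negPf (column_order_neq0 lam pchar0)) val_submod_eq0 /=.
rewrite (mulmx_free_eq0 _ Bfree) -val_submod_eq0 in_submodK //.
exact: polytabloid_neq0.
Qed.

(** The symmetrizer must spare some word over T; the letters of this word in the
    first column are distinct, which bounds the height of the diagram. *)
Lemma specht_occurs_rows (U : 'M[F]_#|{: word n T}|)
    (modU : mxmodule (word_repr F n T) U) :
    mx_rsim (specht_repr F lam) (submod_repr modU) ->
  part lam #|T| = 0%N.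
Proof.
case/specht_occurs=> v _ nz.
have [w nzw] : exists w, word_vec F w *m column_symmetrizer F lam T != 0.
  apply/existsP; apply: contraR nz; rewrite negb_exists => /forallP w0.
  rewrite (row_sum_delta v) mulmx_suml big1 // => i _; rewrite -scalemxAl.
  by have := w0 (enum_val i); rewrite negbK /word_vec enum_valK => /eqP ->;
    rewrite scaler0.
have winj := column_symmetrizer_neq0 pchar0 nzw.
apply/eqP; apply: contraT; rewrite -lt0n => part_gt0.
have cell (r : 'I_#|T|.+1) : exists i,
    (tab_row lam i == r :> nat) && (tab_col lam i == 0).
  have [|i ri ci] := @tab_surj _ lam r 0.
    by apply: leq_trans part_gt0 (part_le _ _); rewrite -ltnS.
  by exists i; rewrite ri ci !eqxx.
pose f r := w (xchoose (cell r)).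
have f_inj : injective f.
  move=> r s frs.
  case/andP: (xchooseP (cell r)) => /eqP rr /eqP cr.
  case/andP: (xchooseP (cell s)) => /eqP rs /eqP cs.
  by apply: val_inj; rewrite /= -rr -rs (winj _ _ _ frs) // cr cs.
have := leq_card f f_inj.
by rewrite card_ord ltnn.
Qed.

End Occurrence.

(** An isomorphism gives words of content mu spared by the symmetrizer of lam,
    and conversely, hence dominance in both directions. *)
Lemma specht_rsim_inj (F : fieldType) (n : nat) (lam mu : partition_of n) :
    [pchar F] =i pred0 ->
  mx_rsim (specht_repr F lam) (specht_repr F mu) -> lam = mu.
Proof.
move=> pchar0; have dom (la nu : partition_of n) k :
    mx_rsim (specht_repr F la) (specht_repr F nu) ->
    (#|[pred i | tab_row nu i < k]| <= #|[pred i | tab_row la i < k]|)%N.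
  case/(specht_occurs pchar0)=> v vS nz.
  have /cyclic_tabloidP[a va] := submx_trans vS (specht_sub_cyclic F nu).
  have [s nzs] : exists s, word_vec F (permute_word (tabloid nu) s) *m
      column_symmetrizer F la 'I_n != 0.
    apply/existsP; apply: contraR nz; rewrite negb_exists => /forallP w0.
    rewrite va mulmx_suml big1 // => s _; rewrite -scalemxAl.
    by have := w0 s; rewrite negbK => /eqP ->; rewrite scaler0.
  exact: tabloid_dominance nzs.
move=> sim; apply: partition_eq_count => k; apply/eqP; rewrite eqn_leq.
by rewrite !dom //; apply: mx_rsim_sym.
Qed.

(** * Action of the sum of transpositions *)

Section PairCounts.
Variables (n : nat) (lam : partition_of n).

Definition row_pairs : nat :=
  #|[pred p : 'I_n * 'I_n | tab_row lam p.1 == tab_row lam p.2]|.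

Definition column_pairs : nat :=
  #|[pred p : 'I_n * 'I_n |
      (p.1 != p.2) && (tab_col lam p.1 == tab_col lam p.2)]|.

Lemma sum_over_rows (f : nat -> nat) :
  (\sum_(x < n) f (tab_row lam x) = \sum_(r < n) part lam r * f r)%N.
Proof.
rewrite (partition_big (tab_row lam) xpredT) //=; apply: eq_bigr => r _.
rewrite -card_tab_row -sum_nat_const; apply: eq_big => [x|x /eqP->//].
by rewrite !inE.
Qed.

Lemma sum_part : (\sum_(r < n) part lam r = n)%N.
Proof.
rewrite -[RHS]card_ord -sum1_card (sum_over_rows (fun=> 1)).
by apply: eq_bigr => r _; rewrite muln1.
Qed.

Lemma row_pairsE : (row_pairs = \sum_(r < n) part lam r ^ 2)%N.
Proof.
rewrite /row_pairs -sum1_card.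
rewrite -(pair_big_dep xpredT
  (fun x y => tab_row lam x == tab_row lam y) (fun _ _ => 1)) /=.
under [RHS]eq_bigr do rewrite -mulnn.
rewrite -sum_over_rows; apply: eq_bigr => x _.
rewrite -card_tab_row -sum1_card; apply: eq_bigl => y.
by rewrite !inE eq_sym.
Qed.

(** A column has at most N cells if the diagram has at most N rows. *)
Lemma column_pairs_le N : part lam N = 0%N -> (column_pairs <= n * N.-1)%N.
Proof.
move=> part0; rewrite /column_pairs -sum1_card.
rewrite -(pair_big_dep xpredT
  (fun x y => (x != y) && (tab_col lam x == tab_col lam y)) (fun _ _ => 1)) /=.
apply: (@leq_trans (\sum_(x < n) N.-1)); last by rewrite sum_nat_const card_ord.
apply: leq_sum => x _.
have row_lt y : (tab_row lam y < N)%N.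
  rewrite ltnNge; apply/negP => /(part_le lam); rewrite part0 leqn0 => /eqP p0.
  by have := tab_col_lt lam y; rewrite p0.
pose A := [set y | tab_col lam x == tab_col lam y].
have leA : (#|A| <= N)%N.
  case: N row_lt {part0} => [/(_ x)//|N row_lt].
  rewrite -[leqRHS]card_ord -(card_in_imset
    (f := fun y => inord (tab_row lam y) : 'I_N.+1)).
    exact: max_card.
  move=> y y'; rewrite !inE => /eqP cy /eqP cy' /(congr1 val) /=.
  rewrite !inordK // => /val_inj ry; apply: (tab_inj ry).
  by rewrite -cy.
rewrite sum1_card; apply: (@leq_trans #|A :\ x|).
  by apply/subset_leq_card/fintype.subsetP => y; rewrite !inE eq_sym.
have := leA; rewrite (cardsD1 x) inE eqxx.
by case: (N).
Qed.

End PairCounts.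

Section Content.
Variables (F : fieldType) (n : nat) (lam : partition_of n).
Local Notation rowT := (tab_row lam).
Local Notation col := (tab_col lam).
Local Notation kappa := (column_symmetrizer F lam 'I_n).
Local Notation e := (polytabloid F lam).
Local Notation rG := (word_repr F n 'I_n).
Hypothesis pchar0 : [pchar F] =i pred0.

Definition tperm_sum : 'M[F]_#|{: word n 'I_n}| :=
  \sum_(p : 'I_n * 'I_n) word_mx F 'I_n (tperm p.1 p.2).
Local Notation Z := tperm_sum.

Lemma tperm_sum_central (s : 'S_n) :
  Z *m word_mx F 'I_n s = word_mx F 'I_n s *m Z.
Proof.
have s2_inj : injective (fun p : 'I_n * 'I_n => (s p.1, s p.2)).
  by case=> [a b] [c d] /= [/perm_inj-> /perm_inj->].
rewrite mulmx_suml mulmx_sumr [RHS](reindex_inj s2_inj) /=.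
by apply: eq_bigr => p _; rewrite !word_mxM -tpermJ conjgC.
Qed.

(** Exchanging x and y fixes the tabloid when they share a row, and changes the
    sign after symmetrization when they share a column.  Otherwise the moved
    letter meets an equal letter of its new column, and the symmetrizer kills
    the word. *)
Lemma tperm_tabloid x y :
  word_vec F (permute_word (tabloid lam) (tperm x y)) *m kappa =
  ((rowT x == rowT y)%:R - ((x != y) && (col x == col y))%:R) *: e.
Proof.
have [rxy|rxy] := eqVneq (rowT x) (rowT y).
  have -> : permute_word (tabloid lam) (tperm x y) = tabloid lam.
    apply/ffunP=> i; rewrite permute_wordE tpermV !ffunE.
    by case: tpermP => // ->.
  have -> : (x != y) && (col x == col y) = false.
    apply/negP=> /andP[/eqP nxy /eqP cxy]; apply: nxy.
    exact: tab_inj cxy.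
  by rewrite subr0 scale1r polytabloidE.
have nxy : x != y by apply: contraNneq rxy => ->.
rewrite nxy /=; have [cxy|cxy] := eqVneq (col x) (col y).
  rewrite -word_vecM -mulmxA column_symmetrizerMl ?column_preserving_tperm //.
  by rewrite odd_tperm nxy expr1 -scalemxAr -polytabloidE sub0r.
rewrite subr0 scale0r; apply/eqP;
  apply: contraT => /(column_symmetrizer_neq0 pchar0).
wlog lt : x y rxy nxy cxy / (rowT x < rowT y)%N => [hw|].
  have [lt|gt|/val_inj eq] := ltngtP (rowT x) (rowT y); first exact: hw.
    by rewrite tpermC; apply: hw => //; rewrite eq_sym.
  by rewrite eq eqxx in rxy.
(* The row of x comes before that of y.  The cell d in the row of x and the
   column of y keeps its letter, and y receives the same one. *)
have [d rd cd] := tab_above (ltnW lt).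
move/(_ d y cd); rewrite !permute_wordE tpermV tpermR !ffunE.
rewrite tpermD; first last.
- by apply: contraTneq lt => ->; rewrite rd ltnn.
- by apply: contraNneq cxy => ->; rewrite cd.
by move=> /(_ (val_inj rd)) dy; rewrite -rd dy ltnn in lt.
Qed.

(** This is twice the sum of the contents (column minus row) of the cells, plus
    the number of cells. *)
Definition content : F := (row_pairs lam)%:R - (column_pairs lam)%:R.

Lemma tperm_sum_polytabloid : e *m Z = content *: e.
Proof.
have Zkappa : kappa *m Z = Z *m kappa.
  rewrite mulmx_suml mulmx_sumr; apply: eq_bigr => s _.
  by rewrite -scalemxAl -scalemxAr tperm_sum_central.
rewrite {1}polytabloidE -mulmxA Zkappa mulmxA [word_vec _ _ *m _]mulmx_sumr mulmx_suml.
under eq_bigr do rewrite word_vecM tperm_tabloid.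
rewrite -scaler_suml sumrB /content; congr ((_ - _) *: _).
  by rewrite /row_pairs -sum1_card natr_sum [RHS]big_mkcond;
    apply: eq_bigr => p _; rewrite inE; case: eqP.
by rewrite /column_pairs -sum1_card natr_sum [RHS]big_mkcond;
  apply: eq_bigr => p _; rewrite inE; case: andP.
Qed.

Lemma tperm_sum_specht m (V : 'M[F]_(m, #|{: word n 'I_n}|)) :
  (V <= specht_mx F lam)%MS -> V *m Z = content *: V.
Proof.
move=> sV; apply/row_matrixP => i; rewrite row_mul linearZ /=.
have /cyclic_mxP[A /envelop_mxP[a ->] ->] := submx_trans (row_sub i V) sV.
rewrite -mulmxA.
have -> : (\sum_(x in [set: 'S_n]) a x *: rG x) *m Z =
          Z *m (\sum_(x in [set: 'S_n]) a x *: rG x).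
  rewrite mulmx_suml mulmx_sumr; apply: eq_bigr => s _.
  by rewrite -scalemxAl -scalemxAr -tperm_sum_central.
by rewrite mulmxA tperm_sum_polytabloid scalemxAl.
Qed.

Lemma specht_trace_tperm :
  \sum_(p : 'I_n * 'I_n) \tr (specht_repr F lam (tperm p.1 p.2)) =
    content * (\rank (specht_mx F lam))%:R.
Proof.
rewrite -linear_sum /=.
have -> : \sum_(p : 'I_n * 'I_n) specht_repr F lam (tperm p.1 p.2) =
    in_submod (specht_mx F lam) (val_submod 1%:M *m Z).
  by rewrite mulmx_sumr linear_sum.
rewrite tperm_sum_specht ?val_submodP // linearZ /= val_submodK.
by rewrite linearZ /= mxtrace1.
Qed.

End Content.

(** * Decomposition of the word representation *)

Section Complete.
Variables (F : closedFieldType) (n : nat).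
Hypothesis pchar0 : [pchar F] =i pred0.

(** Sending lam to the index of its Specht module is injective, and there are
    as many indices as conjugacy classes, hence at most as many as partitions:
    the map is a bijection. *)
Lemma specht_complete d (rS : mx_representation F [set: 'S_n]%G d) :
  mx_irreducible rS ->
  exists lam : partition_of n, mx_rsim (specht_repr F lam) rS.
Proof.
move=> irrS.
pose sG : irrType F [set: 'S_n]%G :=
  DecSocleType (regular_repr F [set: 'S_n]%G).
have p'G := pchar0_pgroup [set: 'S_n]%G pchar0.
have splitG : group_splitting_field F [set: 'S_n]%G.
  exact: group_closure_closed_field.
pose comp (lam : partition_of n) := irr_comp sG (specht_repr F lam).
have rsim_comp lam := rsim_irr_comp_pchar sG p'G (specht_irr lam pchar0).
have comp_inj : injective comp.
  move=> lam mu eq_comp; apply: (specht_rsim_inj pchar0).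
  apply: mx_rsim_trans (rsim_comp lam) _; rewrite -/(comp lam) eq_comp.
  exact: mx_rsim_sym (rsim_comp mu).
have card_sG : (#|sG| <= #|{: partition_of n}|)%N.
  by rewrite (card_irr_pchar sG p'G splitG) card_classes_le_partitions.
have [g _ compK] := inj_card_bij comp_inj card_sG.
exists (g (irr_comp sG rS)).
apply: mx_rsim_trans (rsim_comp _) _; rewrite -/(comp _) compK.
exact/mx_rsim_sym/rsim_irr_comp_pchar.
Qed.

Section Decomposition.
Variable T : finType.
Local Notation rV := (word_repr F n T).
Local Notation sV := (DecSocleType rV).

(** This expresses the character of the word representation in terms of those
    of the Specht modules.  The identity gives the total mass, and the
    transpositions give the second moment. *)
Lemma multiplicity_trace (s : 'S_n) :
  \sum_(lam : partition_of n)
     \tr (specht_repr F lam s) *+ multiplicity rV (specht_repr F lam) =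
  \tr (rV s).
Proof.
have p'G := pchar0_pgroup [set: 'S_n]%G pchar0.
have soc1 : (Socle sV :=: 1%:M)%MS.
  by rewrite reducible_Socle1 //; apply: mx_Maschke_pchar.
rewrite -(mxtrace_submod1 (Socle_module sV) soc1) ?inE // mxtrace_Socle ?inE //.
under eq_bigr do rewrite /multiplicity -sumrMnr big_mkcond /=.
rewrite exchange_big /=; apply: eq_bigr => W _.
have [lam simW] := specht_complete (socle_irr W).
have simC := mx_rsim_sym simW.
rewrite (bigD1 lam) //= asboolT //= big1 ?addr0.
  by rewrite (mxtrace_rsim simW) ?inE.
move=> mu nmu; case: asboolP => // simW'.
case/eqP: nmu; apply: (specht_rsim_inj pchar0).
exact: mx_rsim_trans (mx_rsim_sym simW') simC.
Qed.

Lemma multiplicity_rows (lam : partition_of n) :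
  multiplicity rV (specht_repr F lam) != 0%N -> part lam #|T| = 0%N.
Proof.
rewrite /multiplicity => nz.
have [[W /asboolP simW]|none] :=
  pselect (exists W : sV, `[< mx_rsim (socle_repr W) (specht_repr F lam) >]).
  by apply: (specht_occurs_rows pchar0) (mx_rsim_sym simW).
case/negP: nz; rewrite big_pred0 // => W; apply/negbTE/negP => simW.
by apply: none; exists W.
Qed.

End Decomposition.
End Complete.

(** * Moments of the number of pairs of cells in a common row *)

Section WordTrace.
Variables (F : fieldType) (n : nat) (T : finType).

Lemma word_mx_trace (s : 'S_n) :
  \tr (word_mx F T s) = #|[pred w : word n T | permute_word w s == w]|%:R.
Proof.
transitivity (\sum_(w : word n T) (permute_word w s == w)%:R : F); last first.
  by rewrite -sum1_card natr_sum [RHS]big_mkcond; apply: eq_bigr => w _;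
    rewrite inE; case: eqP.
rewrite [RHS](reindex (@enum_val _ {: word n T})) /=;
  last exact/onW_bij/enum_val_bij.
apply: eq_bigr => i _; rewrite /word_mx /word_vec !mxE eqxx /=.
by rewrite -{1}(enum_valK i) (inj_eq enum_rank_inj) eq_sym.
Qed.

(** Overwriting the letter at x is injective on the pairs of a letter and a
    word with equal letters at x and y, since the overwritten letter can be
    read at y. *)
Lemma card_tperm_fixed (x y : 'I_n) : x != y ->
  (#|T| * #|[pred w : word n T | permute_word w (tperm x y) == w]|
     <= #|T| ^ n)%N.
Proof.
move=> nxy.
pose A := [pred w : word n T | permute_word w (tperm x y) == w].
have -> : (#|T| ^ n = #|{: word n T}|)%N by rewrite card_ffun card_ord.
rewrite -(cardX T (mem A)).
pose f (p : T * word n T) : word n T :=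
  [ffun i => if i == x then p.1 else p.2 i].
rewrite -(card_in_imset (f := f)) ?max_card // => -[a w] [b w'].
have fixed v : v \in A -> v x = v y.
  by rewrite inE => /eqP/ffunP/(_ x); rewrite permute_wordE tpermV tpermL.
rewrite !inE => /= Aw Aw' /ffunP eq_f.
have wE i : i != x -> w i = w' i.
  by move=> ix; have := eq_f i; rewrite !ffunE (negPf ix).
congr pair; first by have := eq_f x; rewrite !ffunE eqxx.
apply/ffunP=> i; have [->|/wE//] := eqVneq i x.
by rewrite !fixed // wE // eq_sym.
Qed.

End WordTrace.

Section Moments.
Variables (F : closedFieldType) (n : nat) (T : finType).
Hypothesis pchar0 : [pchar F] =i pred0.
Local Notation N := #|T|.

Definition mult_dim (lam : partition_of n) : nat :=
  multiplicity (word_repr F n T) (specht_repr F lam) * \rank (specht_mx F lam).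

Lemma natr_inj_pchar0 (a b : nat) : a%:R = b%:R :> F -> a = b.
Proof.
wlog le : a b / (a <= b)%N => [hw|].
  by have [/hw//|/ltnW/hw hba ab] := leqP a b; apply/esym/hba.
move/eqP; rewrite eq_sym -subr_eq0 -natrB //.
have /pcharf0P -> := pchar0; rewrite subn_eq0 => le'.
by apply/eqP; rewrite eqn_leq le.
Qed.

Lemma sum_mult_dim : (\sum_(lam : partition_of n) mult_dim lam = N ^ n)%N.
Proof.
apply: natr_inj_pchar0; have := multiplicity_trace pchar0 T (1%g : 'S_n).
have -> : (N ^ n = #|{: word n T}|)%N by rewrite card_ffun card_ord.
rewrite repr_mx1 mxtrace1 => <-.
rewrite natr_sum; apply: eq_bigr => lam _.
by rewrite repr_mx1 mxtrace1 /mult_dim natrM mulr_natl.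
Qed.

Lemma sum_mult_dim_content :
  (\sum_(lam : partition_of n) mult_dim lam * row_pairs lam =
   \sum_(lam : partition_of n) mult_dim lam * column_pairs lam +
   \sum_(p : 'I_n * 'I_n)
     #|[pred w : word n T | permute_word w (tperm p.1 p.2) == w]|)%N.
Proof.
apply: natr_inj_pchar0; rewrite natrD; apply/eqP; rewrite addrC -subr_eq;
  apply/eqP.
rewrite !natr_sum -sumrB.
under [RHS]eq_bigr do rewrite -word_mx_trace.
under [RHS]eq_bigr => p _ do rewrite -(multiplicity_trace pchar0 T (tperm p.1 p.2)).
rewrite exchange_big /=; apply: eq_bigr => lam _.
rewrite sumrMnl (specht_trace_tperm _ pchar0) /content -[RHS]mulr_natl /mult_dim.
rewrite !natrM.
by rewrite -mulrBr -mulrA; congr (_ * _); rewrite mulrC.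
Qed.

(** Divided by N^(n+1), this is the bound n^2/N + nN on the mean of the number
    of row pairs.  In the sum of traces the n diagonal pairs count N^n each and
    the other ones N^(n-1) each. *)
Lemma second_moment :
  (N * \sum_(lam : partition_of n) mult_dim lam * row_pairs lam <=
   N ^ n * (n ^ 2 + n * N ^ 2))%N.
Proof.
have colsum : (\sum_(lam : partition_of n) mult_dim lam * column_pairs lam <=
    N ^ n * (n * N.-1))%N.
  rewrite -sum_mult_dim big_distrl /=; apply: leq_sum => lam _.
  have [->|nz] := eqVneq (mult_dim lam) 0%N; first by rewrite !mul0n.
  rewrite leq_mul2l column_pairs_le ?orbT //.
  apply: multiplicity_rows => //.
  by apply: contraNneq nz; rewrite /mult_dim => ->.
have fixsum : (N * \sum_(p : 'I_n * 'I_n)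
    #|[pred w : word n T | permute_word w (tperm p.1 p.2) == w]| <=
    \sum_(p : 'I_n * 'I_n) (N ^ n + (p.1 == p.2) * (N ^ n * N.-1)))%N.
  rewrite big_distrr /=; apply: leq_sum => p _.
  have [->|nxy] := eqVneq p.1 p.2; last by rewrite mul0n addn0 card_tperm_fixed.
  rewrite mul1n -mulnS.
  case: (posnP N) => [N0|N0]; first by rewrite N0 mul0n.
  rewrite prednK // mulnC leq_mul2r; apply/orP; right.
  apply: (leq_trans (max_card _)).
  by rewrite card_ffun card_ord.
rewrite sum_mult_dim_content mulnDr.
apply: leq_trans (leq_add (leq_mul (leqnn N) colsum) fixsum) _.
rewrite big_split /= sum_nat_const card_prod card_ord -big_distrl /=.
have -> : (\sum_(p : 'I_n * 'I_n) (p.1 == p.2) = n)%N.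
  rewrite -(pair_big_dep xpredT (fun _ _ => true)
    (fun x y : 'I_n => nat_of_bool (x == y))) /=.
  rewrite -[RHS]card_ord -sum1_card; apply: eq_bigr => x _.
  by rewrite (bigD1 x) //= eqxx big1 // => y; rewrite eq_sym => /negPf->.
rewrite -!mulnn; move: (N ^ n)%N => A.
by case: (N) => [|m] /=; nia.
Qed.

End Moments.

(** * Deviation of the row lengths from their mean *)

Section Mass.
Variables (R : realType) (n N : nat).
Implicit Types lam : partition_of n.
Local Notation mass lam := (schur_weyl_mass R N lam).

Definition row_deviation lam : R :=
  \sum_(k < N) ((part lam k)%:R - n%:R / N%:R) ^+ 2.

Lemma pchar_complex : [pchar R[i]] =i pred0.
Proof. exact: pchar_num. Qed.

Lemma massE lam : mass lam = (mult_dim R[i] 'I_N lam)%:R / N%:R ^+ n.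
Proof. by []. Qed.

Lemma mass_ge0 lam : 0 <= mass lam.
Proof. by rewrite massE divr_ge0 ?exprn_ge0. Qed.

Lemma mass_rows lam : mass lam != 0 -> part lam N = 0%N.
Proof.
move=> nz; rewrite -[in part _ N](card_ord N).
apply: (multiplicity_rows pchar_complex); apply: contraNneq nz => m0.
by rewrite massE /mult_dim m0 mul0n mul0r.
Qed.

Hypothesis N_gt0 : (0 < N)%N.

Lemma sum_mass : \sum_(lam : partition_of n) mass lam = 1.
Proof.
rewrite -mulr_suml -natr_sum (sum_mult_dim n 'I_N pchar_complex) card_ord natrX.
by rewrite mulfV // expf_neq0 // pnatr_eq0 -lt0n.
Qed.

Lemma mean_row_pairs :
  \sum_(lam : partition_of n) mass lam * (row_pairs lam)%:R
    <= n%:R ^+ 2 / N%:R + n%:R * N%:R.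
Proof.
have N0 : 0 < N%:R :> R by rewrite ltr0n.
have := second_moment n 'I_N pchar_complex; rewrite card_ord -(ler_nat R).
rewrite !natrM natrD natrM !natrX natr_sum => le.
have -> : \sum_(lam : partition_of n) mass lam * (row_pairs lam)%:R =
   (\sum_(lam : partition_of n) (mult_dim R[i] 'I_N lam * row_pairs lam)%:R)
     / N%:R ^+ n :> R.
  by rewrite mulr_suml; apply: eq_bigr => lam _; rewrite massE natrM mulrAC.
rewrite ler_pdivrMr ?exprn_gt0 // -(ler_pM2l N0).
apply: (le_trans le); rewrite le_eqVlt; apply/orP; left; apply/eqP.
by field; rewrite ?gt_eqF.
Qed.

Lemma sum_part_widen (f : nat -> R) lam m m' : f 0%N = 0 -> part lam m = 0%N ->
  (m <= m')%N -> \sum_(k < m') f (part lam k) = \sum_(k < m) f (part lam k).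
Proof.
move=> f0 part0 le;
  rewrite -(subnKC le) big_split_ord /= [X in _ + X]big1 ?addr0 //.
move=> i _; have := part_le lam (leq_addr i m); rewrite part0 leqn0 => /eqP->.
exact: f0.
Qed.

Lemma sum_part_rows (f : nat -> R) lam : f 0%N = 0 -> part lam N = 0%N ->
  \sum_(k < N) f (part lam k) = \sum_(k < n) f (part lam k).
Proof.
move=> f0 part0;
  have partn : part lam n = 0%N by rewrite /part nth_default ?size_parts.
rewrite -(sum_part_widen f0 part0 (leq_maxl N n)).
by rewrite -(sum_part_widen f0 partn (leq_maxr N n)).
Qed.

(** All the cells lie in the first N rows, so the cross term is 2 n^2/N. *)
Lemma row_deviationE lam : part lam N = 0%N ->
  row_deviation lam = (row_pairs lam)%:R - n%:R ^+ 2 / N%:R.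
Proof.
move=> part0; have N0 : N%:R != 0 :> R by rewrite pnatr_eq0 -lt0n.
have -> : row_deviation lam = \sum_(k < N) (part lam k)%:R ^+ 2
    - (n%:R / N%:R *+ 2) * \sum_(k < N) (part lam k)%:R
    + \sum_(k < N) (n%:R / N%:R) ^+ 2.
  rewrite mulr_sumr -sumrB -big_split /=; apply: eq_bigr => k _.
  by rewrite sqrrB; ring.
rewrite (sum_part_rows (f := fun k => k%:R ^+ 2)) ?expr0n //.
rewrite (sum_part_rows (f := fun k => k%:R)) // -natr_sum sum_part.
rewrite sumr_const card_ord row_pairsE natr_sum.
under [X in _ = X - _]eq_bigr do rewrite natrX.
rewrite -[in (_ / _) ^+ 2 *+ N]mulr_natr.
by field.
Qed.

Lemma mean_row_deviation :
  \sum_(lam : partition_of n) mass lam * row_deviation lam <= n%:R * N%:R.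
Proof.
have -> : \sum_(lam : partition_of n) mass lam * row_deviation lam =
    \sum_(lam : partition_of n) mass lam * (row_pairs lam)%:R - n%:R ^+ 2 / N%:R.
  rewrite -[X in _ - X]mul1r -[X in _ - X * _]sum_mass mulr_suml -sumrB;
    apply: eq_bigr => lam _.
  have [->|/mass_rows part0] := eqVneq (mass lam) 0;
    first by rewrite !mul0r subr0.
  by rewrite row_deviationE // mulrBr.
by rewrite lerBlDl mean_row_pairs.
Qed.

Lemma row_deviation_ge0 lam : 0 <= row_deviation lam.
Proof. by apply: sumr_ge0 => k _; apply: sqr_ge0. Qed.

Lemma prob_ge (A : set (partition_of n)) (theta : R) : 0 < theta ->
    (forall lam, part lam N = 0%N -> row_deviation lam < theta -> A lam) ->
  1 - n%:R * N%:R / theta <= schur_weyl_prob R N A.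
Proof.
move=> theta0 hA; rewrite /schur_weyl_prob.
have := sum_mass;
  rewrite (bigID (fun lam => `[< A lam >])) /= => /(canRL (addrK _))->.
rewrite lerD2l lerN2 ler_pdivlMr //; apply: le_trans mean_row_deviation.
rewrite [leRHS](bigID (fun lam => `[< A lam >])) /= mulr_suml.
apply: ler_wpDl.
  by apply: sumr_ge0 => lam _; rewrite mulr_ge0 ?mass_ge0 ?row_deviation_ge0.
apply: ler_sum => lam /asboolP nA.
have [->|/mass_rows part0] := eqVneq (mass lam) 0; first by rewrite !mul0r.
rewrite ler_wpM2l ?mass_ge0 // leNgt; apply/negP => lt; apply: nA.
exact: hA.
Qed.

End Mass.

Section Geometry.
Variables (R : realType) (n N : nat) (lam : partition_of n).
Local Notation r := (n%:R / N%:R : R).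
Local Notation V := (row_deviation R N lam).

Lemma row_deviation_upper (j : nat) (x D : R) :
  0 <= D -> r + D <= x -> (j <= N)%N ->
  (forall k, (k < j)%N -> x <= (part lam k)%:R) -> j%:R * D ^+ 2 <= V.
Proof.
move=> D0 rD jN hx; rewrite /row_deviation -(subnKC jN) big_split_ord /=.
apply: ler_wpDr; first by apply: sumr_ge0 => k _; apply: sqr_ge0.
rewrite mulr_natl -[X in _ *+ X](card_ord j) -sumr_const.
rewrite subnKC //; apply: ler_sum => k _.
by rewrite ler_sqr ?nnegrE //; have := hx k (ltn_ord k); lra.
Qed.

Lemma row_deviation_lower (j : nat) (x D : R) :
  0 <= D -> x <= r - D -> (j <= N)%N ->
  (forall k, (j <= k)%N -> (part lam k)%:R <= x) -> (N%:R - j%:R) * D ^+ 2 <= V.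
Proof.
move=> D0 rD jN hx; rewrite /row_deviation.
rewrite -(big_mkord xpredT (fun k => ((part lam k)%:R - r) ^+ 2)).
rewrite (big_cat_nat (leq0n j) jN) /=.
apply: ler_wpDl; first by apply: sumr_ge0 => k _; apply: sqr_ge0.
rewrite -natrB // [leLHS]mulr_natl -sumr_const_nat.
apply: ler_sum_nat => k /andP[jk _].
rewrite -[leRHS]sqrrN ler_sqr ?nnegrE //; have := hx k jk; lra.
Qed.

End Geometry.

(** * Shape of the rescaled border *)

Local Open Scope classical_set_scope.

Section Region.
Variables (R : realType) (n N : nat) (lam : partition_of n).

(** The number b tends to 1 in the application, and the four inequalities on b
    are what survives of this limit.  Since rows decrease, a border point above
    the region on the right certifies that all the rows below it are long, and
    a border point below the region on the left certifies that all the rows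
    above it are short. *)
Lemma border_region (alpha c eta : R) :
    (0 < n)%N -> (0 < N)%N -> 0 < c -> 0 < eta ->
    let b := c * N%:R / n%:R `^ alpha in
    1 + eta / 4 <= (1 + eta / 2) * b -> b <= 2 ->
    (1 - eta / 2) * b <= 1 - eta / 4 -> 1 - eta <= (1 - eta / 2) * b ->
    part lam N = 0%N ->
    row_deviation R N lam < (eta / 2 * N%:R) * (eta / 4 * (n%:R / N%:R)) ^+ 2 ->
  rescaled_border alpha lam `<=`
    limit_region c eta (Num.max c^-1 (N%:R / n%:R `^ alpha)).
Proof.
move=> n_gt0 N_gt0 c0 eta0 b b_up b2 b_dn b_ht part0 dev _ [q border_q <-] /=.
have nR0 : 0 < n%:R :> R by rewrite ltr0n.
have NR0 : 0 < N%:R :> R by rewrite ltr0n.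
set X := n%:R `^ (1 - alpha); set Y := n%:R `^ alpha.
have X0 : 0 < X by apply: powR_gt0.
have Y0 : 0 < Y by apply: powR_gt0.
have XY : X * Y = n%:R.
  by rewrite /X /Y -powRD ?subrK ?powRr1 ?ltW // gt_eqF // implybT.
have b0 : 0 < b by rewrite /b divr_gt0 // mulr_gt0.
set r := n%:R / N%:R in dev.
have r0 : 0 < r by apply: divr_gt0.
(* In the units of a row of mean length and of the number of rows, the corner
   (c, 1/c) of the limit shape is (b, 1/b). *)
have cX : c * X = b * r.
  by rewrite /b /r -/Y -XY; field; rewrite !gt_eqF.
have cY : c^-1 * Y = N%:R / b.
  by rewrite /b -/Y; field; rewrite !gt_eqF // andbT.
have [k [k_gt0 q_k]] := border_q.
have kN : (k < N)%N.
  rewrite ltnNge; apply/negP => /(part_le lam); rewrite part0 leqn0 => /eqP pk.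
  by rewrite pk in k_gt0.
have [q1_ge0 [q1_le [q2_ge q2_le]]] : 0 <= q.1 /\ q.1 <= (part lam k)%:R /\
    k%:R <= q.2 /\ q.2 <= k.+1%:R.
  case: q_k => [[-> /andP[-> ->]]|[/andP[le_q1 ->] ->]].
    by rewrite ler0n lexx.
  by rewrite (le_trans _ le_q1) ?ler0n // ler_nat leqnSn lexx.
(* The rows from j on end at or before the abscissa of q: j is k on the right
   side of the row k, and k.+1 on its top side. *)
have [j [jN jq rows_j]] : exists j : nat, [/\ (j <= N)%N, j%:R <= q.2 &
    forall i, (j <= i)%N -> (part lam i)%:R <= q.1].
  case: q_k => [[-> /andP[? ?]]|[/andP[? ?] q2]].
    exists k; split=> //; first exact: ltnW.
    by move=> i ki; rewrite ler_nat part_le.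
  exists k.+1; split=> //; first by rewrite q2.
  by move=> i ki; apply: le_trans (_ : (part lam k.+1)%:R <= _);
    rewrite ?ler_nat ?part_le.
have q2_ge0 : 0 <= q.2 by apply: le_trans q2_ge.
have p1_ge0 : 0 <= q.1 / X by rewrite divr_ge0 // ltW.
have p2_ge0 : 0 <= q.2 / Y by rewrite divr_ge0 // ltW.
have p2_le : q.2 / Y <= Num.max c^-1 (N%:R / Y).
  rewrite le_max; apply/orP; right; rewrite ler_pM2r ?invr_gt0 //.
  by apply: le_trans q2_le _; rewrite ler_nat.
have D0 : 0 <= eta / 4 * r by rewrite mulr_ge0 ?divr_ge0 ?ltW.
have [p1_lt|p1_ge] := ltP (q.1 / X) (c * (1 - eta / 2)).
  left; left; split; first by rewrite p1_ge0 ltW.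
  rewrite p2_le andbT leNgt; apply/negP => p2_lt.
  have q1_lt : q.1 < b * r * (1 - eta / 2).
    by rewrite -cX; move: p1_lt; rewrite ltr_pdivrMr // mulrAC.
  have q2_lt : q.2 < N%:R / b * (1 - eta).
    by rewrite -cY; move: p2_lt; rewrite ltr_pdivrMr // mulrAC.
  have low : q.1 <= r - eta / 4 * r.
    have := ler_wpM2r (ltW r0) b_dn; lra.
  have := row_deviation_lower D0 low jN rows_j.
  apply/negP; rewrite -ltNge; apply: (lt_le_trans dev).
  apply: ler_wpM2r; first exact: sqr_ge0.
  have : N%:R / b * (1 - eta) <= (1 - eta / 2) * N%:R.
    by rewrite mulrAC ler_pdivrMr // mulrC [leRHS]mulrAC ler_pM2r.
  lra.
have [p1_le|p1_gt] := leP (q.1 / X) (c * (1 + eta / 2)).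
  by left; right; split=> //; rewrite p1_ge p1_le p2_ge0 p2_le.
right; split; first exact: ltW.
rewrite p2_ge0 leNgt /=; apply/negP => p2_gt.
have q1_gt : b * r * (1 + eta / 2) < q.1.
  by rewrite -cX; move: p1_gt; rewrite ltr_pdivlMr // mulrAC.
have q2_gt : N%:R / b * eta < q.2.
  by rewrite -cY; move: p2_gt; rewrite ltr_pdivlMr // mulrAC.
have up : r + eta / 4 * r <= q.1.
  have := ler_wpM2r (ltW r0) b_up; lra.
have rows_k i : (i < k.+1)%N -> q.1 <= (part lam i)%:R.
  by rewrite ltnS => ik; apply: (le_trans q1_le); rewrite ler_nat part_le.
have := row_deviation_upper D0 up kN rows_k.
apply/negP; rewrite -ltNge; apply: (lt_le_trans dev).
apply: ler_wpM2r; first exact: sqr_ge0.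
have : N%:R / 2 * eta <= N%:R / b * eta.
  by rewrite ler_pM2r // ler_pM2l // lef_pV2 ?posrE.
lra.
Qed.

End Region.

Lemma powR_eventually_ge (R : realType) (p K : R) : 0 < p ->
  exists n0 : nat, forall n : nat, (n0 <= n)%N -> K <= n%:R `^ p.
Proof.
move=> p0; have [K0|K0] := leP K 0.
  by exists 0%N => n _; apply: (le_trans K0); apply: powR_ge0.
exists (Num.truncn (K `^ p^-1)).+1 => n le_n.
have le : K `^ p^-1 <= n%:R.
  have := truncnS_gt (K `^ p^-1); move/ltW/le_trans; apply.
  by rewrite ler_nat.
have := @ge0_ler_powR R p (ltW p0) (K `^ p^-1) n%:R.
rewrite !nnegrE powR_ge0 ler0n => /(_ isT isT le).
by rewrite -powRrM mulVf ?gt_eqF // powRr1 // ltW.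
Qed.

Theorem theorem3 (R : realType) (c alpha : R) (N : nat -> nat)
    (c_gt0 : 0 < c) (alpha_lt : alpha < 1 / 2)
    (N_gt0 : forall n : nat, (1 <= n)%N -> (0 < N n)%N)
    (N_equiv : (fun n : nat => (N n)%:R : R)
                 ~_\oo (fun n : nat => c^-1 * n%:R `^ alpha)) :
  forall eps eta : R, 0 < eps -> 0 < eta ->
  exists n0 : nat, forall n : nat, (1 <= n)%N -> (n0 <= n)%N ->
    1 - eps <
      schur_weyl_prob R (N n)
        [set lam : partition_of n |
          rescaled_border alpha lam `<=`
            limit_region c eta (Num.max c^-1 ((N n)%:R / n%:R `^ alpha))].
Proof.
move=> eps eta eps0 eta0.
(* If c N / n^alpha is within d of 1, it satisfies the inequalities on b of the
   deterministic lemma. *)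
pose d := Num.min 1 (eta / 4 / (1 + eta / 2)).
have d0 : 0 < d by rewrite lt_min ltr01 !divr_gt0 // addr_gt0 // divr_gt0.
have d1 : d <= 1 by rewrite ge_min lexx.
have d_eta : (1 + eta / 2) * d <= eta / 4.
  by rewrite mulrC -ler_pdivlMr ?ge_min ?lexx ?orbT // addr_gt0 // divr_gt0.
have [n1 _ N_near] : \forall n \near \oo,
    `|(N n)%:R - c^-1 * n%:R `^ alpha| <= d * `|c^-1 * n%:R `^ alpha|.
  by move: N_equiv => /eqaddoP/(_ d d0).
have p0 : 0 < 1 - 2 * alpha by lra.
(* With b <= 2, N^2 <= (4 / c^2) n^(2 alpha); Markov's bound
   32 N^2 / (eta^3 n) is below eps once n^(1 - 2 alpha) exceeds 128 / (c^2 eta^3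
   eps). *)
pose K := 128 / (c ^+ 2 * eta ^+ 3 * eps) + 1.
have [n2 pow_ge] := powR_eventually_ge K p0.
exists (maxn n1 n2) => n n_gt0; rewrite geq_max => /andP[le1 le2].
have {N_near}:= N_near n le1; have {pow_ge}:= pow_ge n le2.
have {N_gt0}:= N_gt0 n n_gt0; move: (N n) => {N N_equiv} N N_gt0 pow_ge near_N.
have nR0 : 0 < n%:R :> R by rewrite ltr0n.
have NR0 : 0 < N%:R :> R by rewrite ltr0n.
have Y0 : 0 < n%:R `^ alpha by apply: powR_gt0.
pose b := c * N%:R / n%:R `^ alpha.
have b_near : `|b - 1| <= d.
  have -> : b - 1 = (N%:R - c^-1 * n%:R `^ alpha) / (c^-1 * n%:R `^ alpha).
    by rewrite /b; field; rewrite !gt_eqF.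
  have cY0 : 0 < c^-1 * n%:R `^ alpha by rewrite mulr_gt0 // invr_gt0.
  by rewrite normrM normfV ler_pdivrMr ?normr_gt0 ?gt_eqF.
have [b_lo b_hi] : 1 - d <= b /\ b <= 1 + d.
  by move: b_near; rewrite ler_norml => /andP[? ?]; split; lra.
have b_tilt : `|(1 - eta / 2) * (b - 1)| <= eta / 4.
  rewrite normrM; apply: le_trans d_eta.
  apply: ler_pM => //.
  by rewrite ler_norml; apply/andP; split; lra.
pose theta : R := (eta / 2 * N%:R) * (eta / 4 * (n%:R / N%:R)) ^+ 2.
have theta0 : 0 < theta.
  by rewrite /theta mulr_gt0 // ?exprn_gt0 // !mulr_gt0 // ?invr_gt0 // divr_gt0.
apply: lt_le_trans (prob_ge N_gt0 theta0 _); last first.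
  move=> lam part0 dev /=; apply: border_region => //; rewrite -/b.
  - have : (1 + eta / 2) * (1 - d) <= (1 + eta / 2) * b.
      by rewrite ler_pM2l //; lra.
    lra.
  - lra.
  - by move: b_tilt; rewrite ler_norml => /andP[? ?]; lra.
  - by move: b_tilt; rewrite ler_norml => /andP[? ?]; lra.
rewrite ltrD2l ltrN2 ltr_pdivrMr //.
have N_le : N%:R <= 2 / c * n%:R `^ alpha.
  have : b <= 2 by lra.
  rewrite /b ler_pdivrMr // => le.
  by rewrite mulrAC ler_pdivlMr // mulrC.
set Y := n%:R `^ alpha in N_le Y0 *; set W := n%:R `^ (1 - 2 * alpha) in pow_ge.
have nE : n%:R = Y ^+ 2 * W.
  rewrite /Y /W -powR_mulrn ?powR_ge0 // -powRrM -powRD; last first.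
    by apply/implyP => _; rewrite gt_eqF.
  by rewrite -[LHS]powRr1 ?ltW //; congr (_ `^ _); ring.
have N2_le : N%:R ^+ 2 <= 4 / c ^+ 2 * Y ^+ 2.
  have -> : 4 / c ^+ 2 * Y ^+ 2 = (2 / c * Y) ^+ 2 by field; rewrite gt_eqF.
  by rewrite ler_sqr // nnegrE ltW // mulr_gt0 // divr_gt0.
have ceps0 : 0 < c ^+ 2 * eta ^+ 3 * eps by rewrite !mulr_gt0 ?exprn_gt0.
have W_gt : 128 / (c ^+ 2 * eta ^+ 3 * eps) < W by rewrite (lt_le_trans _ pow_ge) ?ltrDl.
have -> : eps * theta = eps * eta ^+ 3 * n%:R ^+ 2 / 32 / N%:R.
  by rewrite /theta; field; rewrite gt_eqF.
rewrite !ltr_pdivlMr //.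
have -> : n%:R * N%:R * N%:R * 32 = n%:R * (N%:R ^+ 2 * 32) :> R by ring.
have -> : eps * eta ^+ 3 * n%:R ^+ 2 = n%:R * (eps * eta ^+ 3 * n%:R) by ring.
rewrite ltr_pM2l //.
apply: (@le_lt_trans _ _ (128 / c ^+ 2 * Y ^+ 2)).
  have -> : 128 / c ^+ 2 * Y ^+ 2 = 4 / c ^+ 2 * Y ^+ 2 * 32 by field;
    rewrite gt_eqF.
  by rewrite ler_pM2r.
have -> : 128 / c ^+ 2 * Y ^+ 2 =
    (eps * eta ^+ 3 * Y ^+ 2) * (128 / (c ^+ 2 * eta ^+ 3 * eps)).
  by field; rewrite !gt_eqF.
rewrite nE [ltRHS]mulrA ltr_pM2l // !mulr_gt0 ?exprn_gt0 //.
Qed.
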